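(* Consider the rate-distortion problem defined by a source distribution $p_X$ on a finite alphabet $\mathcal{X}$ and a distortion $d:\mathcal{X}\times\hat{\mathcal{X}}\to\mathbb{R}_{\ge0}$ with $\hat{\mathcal{X}}$ finite. Let $\bm{r}$ be a fixed point of $BA_\beta$ outside the simplex boundary, i.e. $r(\hat{x})>0$ for all $\hat{x}$. Assume that in a neighborhood of the given value of $\beta$ there is a function $\beta\mapsto\bm{r}_\beta$ through $\bm{r}$ consisting of fixed points of $BA_\beta$, and that it is differentiable as many times as needed at the given $\beta$. Then for every $\hat{x}\in\hat{\mathcal{X}}$, $$\sum_{\hat{x}'}A_{\hat{x},\hat{x}'}\frac{dr(\hat{x}')}{d\beta}=\sum_{x,\hat{x}'}p_X(x)\,q(\hat{x}'|x)\,q(\hat{x}|x)\,d(x,\hat{x}')-\sum_x p_X(x)\,q(\hat{x}|x)\,d(x,\hat{x}),$$ where $q(\hat{x}|x):=\frac{r(\hat{x})e^{-\beta d(x,\hat{x})}}{\sum_{\hat{x}'}r(\hat{x}')e^{-\beta d(x,\hat{x}')}}$ and $A_{\hat{x},\hat{x}'}:=\sum_x p_X(x)\frac{q(\hat{x}'|x)\,q(\hat{x}|x)}{r(\hat{x}')}$.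
   Context: The Blahut-Arimoto operator at $\beta>0$ maps a distribution $\bm{r}$ on $\hat{\mathcal{X}}$ to $BA_\beta[\bm{r}](\hat{x}):=\sum_x p_X(x)q(\hat{x}|x)$ with $q$ given in terms of $\bm{r}$ and $\beta$ as in the claim. A fixed point is $\bm{r}$ with $BA_\beta[\bm{r}]=\bm{r}$. *)

(* Defs.v *)
From HB Require Import structures.
From mathcomp Require Import all_boot all_order all_algebra.
From mathcomp Require Import all_classical all_reals all_analysis.

Set Implicit Arguments.
Unset Strict Implicit.
Unset Printing Implicit Defensive.

Import Order.TTheory GRing.Theory Num.Theory.
Import numFieldNormedType.Exports.

Local Open Scope ring_scope.

Definition is_distribution (R : realType) (T : finType) (p : T -> R) : Prop :=
  (forall t, 0 <= p t) /\ \sum_t p t = 1.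

(* Test channel [q(xh | x)] induced by the reproduction distribution [r] at
   [beta]; note the order of the arguments: the conditioning letter [x] comes
   first.  The denominator is positive whenever [r] is a distribution. *)
Definition channel (R : realType) (X Xh : finType) (d : X -> Xh -> R)
    (beta : R) (r : Xh -> R) (x : X) (xh : Xh) : R :=
  (r xh * expR (- beta * d x xh)) /
  (\sum_(xh' : Xh) r xh' * expR (- beta * d x xh')).

(* Blahut-Arimoto operator, defined for every [r]; it maps distributions to
   distributions when [p] is one, hence the first clause of
   [BA_fixed_point]. *)
Definition BA (R : realType) (X Xh : finType) (p : X -> R) (d : X -> Xh -> R)
    (beta : R) (r : Xh -> R) (xh : Xh) : R :=
  \sum_(x : X) p x * channel d beta r x xh.

Definition BA_fixed_point (R : realType) (X Xh : finType) (p : X -> R)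
    (d : X -> Xh -> R) (beta : R) (r : Xh -> R) : Prop :=
  is_distribution r /\ BA p d beta r =1 r.

Definition Amat (R : realType) (X Xh : finType) (p : X -> R)
    (d : X -> Xh -> R) (beta : R) (r : Xh -> R) (xh xh' : Xh) : R :=
  \sum_(x : X) p x *
    ((channel d beta r x xh' * channel d beta r x xh) / r xh').

(* Main.v *)
(* Differentiate the fixed-point equation [BA_b (r_b) = r_b] in [b].  With
   [l y = r'(y) / r(y) - d x y] the logarithmic derivative of the weight
   [r(y) exp (- b d x y)], the channel satisfies
   [q'(xh|x) = q(xh|x) (l xh - \sum_y q(y|x) l y)].  Averaging over [p], the
   term [\sum_x p x q(xh|x) r'(xh) / r(xh)] equals [r'(xh)], again by the
   fixed-point equation, and cancels against the right-hand side. *)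
Require Import Defs.
From HB Require Import structures.
From mathcomp Require Import all_boot all_order all_algebra.
From mathcomp Require Import all_classical all_reals all_analysis.
From mathcomp Require Import ring.

Import Order.TTheory GRing.Theory Num.Theory.
Import numFieldNormedType.Exports.

Local Open Scope classical_set_scope.
Local Open Scope ring_scope.

(** The derivative rules for constants and sums act on a sum taken in the space of functions; by
    extensionality it is the pointwise sum used here. *)
Lemma is_derive_sum_fin (R : realType) (I : finType) (h : I -> R -> R)
    (dh : I -> R) (x : R) :
  (forall i, is_derive x 1 (h i) (dh i)) ->
  is_derive x 1 (fun b => \sum_i h i b) (\sum_i dh i).
Proof.
move=> Dh; rewrite -(_ : \sum_i h i = fun b => \sum_i h i b).
  by elim/big_ind2 : _ => // [|] *; [exact: is_derive_cst|exact: is_deriveD].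
by apply/funext => b; rewrite fct_sumE.
Qed.

Section Channel.
Context {R : realType} {X Xh : finType}.
Variables (d : X -> Xh -> R) (beta : R).

(** The bare argument [Xh] is a witness that the alphabet is nonempty; an empty sum would be 0. *)
Lemma partition_gt0 (r : Xh -> R) (x : X) :
  (forall xh, 0 < r xh) -> Xh ->
  0 < \sum_xh r xh * expR (- beta * d x xh).
Proof.
move=> r_gt0 xh; rewrite (bigD1 xh)//=; apply: ltr_pwDl.
  by rewrite mulr_gt0 ?expR_gt0.
by apply: sumr_ge0 => y _; rewrite mulr_ge0 ?expR_ge0 ?ltW.
Qed.

(** The value is factored as the weight times its logarithmic derivative, hence the division by
    [s beta]. *)
Lemma is_derive_weight (s : R -> R) (ds c : R) : s beta != 0 ->
  is_derive beta 1 s ds ->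
  is_derive beta 1 (fun b => s b * expR (- b * c))
    (s beta * expR (- beta * c) * (ds / s beta - c)).
Proof.
move=> s_neq0 Ds.
have Dl : is_derive beta 1 (fun b : R => - b * c) (- c).
  have -> : (fun b : R => - b * c) = (- c) \*: id.
    by apply/funext => b; rewrite /= mulNr -mulrN mulrC.
  by apply: is_derive_eq; rewrite [LHS]mulr1.
have De := @is_derive1_comp R expR (fun b => - b * c) beta _ _
  (is_derive_expR _) Dl.
apply: (is_derive_eq (is_deriveM Ds De)).
rewrite /= /GRing.scale /=; field; exact: s_neq0.
Qed.

(** By the quotient rule, the logarithmic derivative of the weight is diminished by that of the
    partition function, which is the mean of [l] under [q]. *)
Lemma is_derive_channel (rb : R -> Xh -> R) (dr : Xh -> R) (x : X) (xh : Xh) :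
  let q := channel d beta (rb beta) x in
  let l := fun y => dr y / rb beta y - d x y in
  (forall y, 0 < rb beta y) ->
  (forall y, is_derive beta 1 (fun b => rb b y) (dr y)) ->
  is_derive beta 1 (fun b => channel d b (rb b) x xh)
    (q xh * (l xh - \sum_y q y * l y)).
Proof.
move=> q l rb_gt0 Drb.
pose w b y := rb b y * expR (- b * d x y).
have Dw y : is_derive beta 1 (w ^~ y) (w beta y * l y).
  by apply: is_derive_weight => //; rewrite gt_eqF.
have DZ := is_derive_sum_fin _ _ _ _ _ Dw.
have Z_neq0 : \sum_y w beta y != 0 by rewrite gt_eqF// partition_gt0.
apply: (is_derive_eq (is_deriveM (Dw xh) (is_deriveV Z_neq0 DZ))).
have -> : \sum_y q y * l y = (\sum_y w beta y * l y) / \sum_y w beta y.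
  by rewrite mulr_suml; apply: eq_bigr => y _; rewrite mulrAC.
rewrite /q /channel -/(w beta xh) -[X in _ / X]/(\sum_y w beta y).
rewrite /= /GRing.scale /=; field; exact: Z_neq0.
Qed.

End Channel.

Theorem theorem14 (R : realType) (X Xh : finType)
    (p : X -> R) (d : X -> Xh -> R) (beta : R)
    (r : Xh -> R) (rb : R -> Xh -> R)
    (p_distr : is_distribution p)
    (d_ge0 : forall x xh, 0 <= d x xh)
    (beta_gt0 : 0 < beta)
    (r_fixed : BA_fixed_point p d beta r)
    (r_gt0 : forall xh, 0 < r xh)
    (rb_through : rb beta = r)
    (rb_fixed : \forall b \near beta, BA_fixed_point p d b (rb b))
    (rb_derivable : forall xh, derivable (fun b : R => rb b xh) beta 1) :
  let q := channel d beta r in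
  forall xh : Xh,
    \sum_(xh' : Xh) Amat p d beta r xh xh' * derive1 (fun b : R => rb b xh') beta
    = \sum_(x : X) \sum_(xh' : Xh) p x * q x xh' * q x xh * d x xh'
      - \sum_(x : X) p x * q x xh * d x xh.
Proof.
move=> q xh.
set dr := fun y => derive1 (fun b : R => rb b y) beta.
have Drb y : is_derive beta 1 (fun b => rb b y) (dr y).
  by rewrite /dr derive1E; exact: derivableP.
have rb_gt0 y : 0 < rb beta y by rewrite rb_through.
have DBA : is_derive beta 1 (fun b => BA p d b (rb b) xh)
    (\sum_x p x * (q x xh * ((dr xh / r xh - d x xh) -
       \sum_y q x y * (dr y / r y - d x y)))).
  apply: (is_derive_sum_fin _ _ (fun x b => p x * channel d b (rb b) x xh)) => x.
  have := is_derive_channel d beta rb dr x xh rb_gt0 Drb.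
  rewrite /= rb_through => Dq.
  exact: (is_deriveZ (p x) Dq).
(* Equality on a neighborhood, not just at [beta], is what lets both sides be differentiated. *)
have BA_rb : {near beta, (fun b => BA p d b (rb b) xh) =1 (fun b => rb b xh)}.
  by apply: filterS rb_fixed => b [_ ->].
have Erb : \sum_x p x * q x xh = r xh by case: r_fixed => _ <-.
have Edr : \sum_x p x * (q x xh * (dr xh / r xh)) = dr xh.
  under eq_bigr do rewrite mulrA.
  by rewrite -mulr_suml Erb mulrC divfK// gt_eqF.
have Ddr : 'D_1 (fun b => BA p d b (rb b) xh) beta = dr xh.
  by rewrite (near_eq_derive _ BA_rb) (@derive_val _ _ _ _ _ _ _ (Drb xh)).
(* Equate the two values of the derivative of [BA], write [dr xh] as the sum in [Edr] and cancel:
   only the distortion and the mean of the logarithmic derivatives remain. *)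
have Eq : \sum_x p x * q x xh * \sum_y q x y * (dr y / r y - d x y)
    = - \sum_x p x * q x xh * d x xh.
  move: Ddr; rewrite (@derive_val _ _ _ _ _ _ _ DBA) -[RHS]Edr => /eqP.
  rewrite -subr_eq0 -sumrB => /eqP E; apply/eqP.
  rewrite -addr_eq0 -big_split/= -oppr_eq0 -sumrN; apply/eqP.
  by rewrite -[RHS]E; apply: eq_bigr => x _; ring.
(* Once [Eq] replaces the single sum, the distortion part of the mean cancels the double sum. What
   is left, [p x * q x y * q x xh * dr y / r y] summed over [x] and [y], is [Amat] applied to [dr]
   after exchanging the sums. *)
rewrite -Eq -big_split/=.
under eq_bigr do rewrite /Amat mulr_suml.
rewrite exchange_big/=; apply: eq_bigr => x _.
rewrite mulr_sumr -big_split/=; apply: eq_bigr => y _; rewrite -/q -/(dr y).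
by field; rewrite gt_eqF.
Qed.
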